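(* Let $k$ and $l$ be fixed positive integers. Then: (i) For $l\ge 2$ there exists a constant $c$ (depending only on $k$ and $l$) such that for every integer $n\ge 2k+1$, $$\mathrm{ex}(J(n;k,k+1),C_{4l})\le \Big(c\,(n-k)^{-\frac12+\frac{1}{2l}}+\frac{1}{\sqrt{k+1}}\Big)\,e(J(n;k,k+1)).$$ (ii) For $l\ge 1$ there is a function $f(n)=f_{k,l}(n)$ with $\lim_{n\to\infty}f(n)=0$ such that for every integer $n\ge 2k+1$, $$\mathrm{ex}(J(n;k,k+1),C_{4l+2})\le \Big(\frac{1}{2(k+1)}+\frac{\sqrt2}{2}+f(n)\Big)\,e(J(n;k,k+1)).$$
   Context: For positive integers $n\ge k+1$, the doubled Johnson graph $J(n;k,k+1)$ is the bipartite graph with vertex set $\binom{[n]}{k}\cup\binom{[n]}{k+1}$ (all $k$-subsets and $(k+1)$-subsets of $[n]=\{1,\dots,n\}$), where two vertices $u,v$ are adjacent iff $u\subset v$ or $v\subset u$. It has $e(J(n;k,k+1))=(n-k)\binom{n}{k}=(k+1)\binom{n}{k+1}$ edges. $C_m$ denotes the cycle of length $m$. For graphs $G,H$, the generalized Turán number $\mathrm{ex}(G,H)$ is the maximum number of edges of a subgraph of $G$ containing no subgraph isomorphic to $H$. *)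

(* Defs.v *)
From mathcomp Require Import all_boot.
Set Implicit Arguments. Unset Strict Implicit. Unset Printing Implicit Defensive.

(* Vertices of J(n;k,k+1): subsets of [n] = 'I_n (of size k or k+1).
   An edge is stored as an ordered pair (A, B) with #|A| = k, #|B| = k+1,
   A \subset B (A the k-set, B the (k+1)-set). *)
Definition Jedges (n k : nat) : {set {set 'I_n} * {set 'I_n}} :=
  [set p : {set 'I_n} * {set 'I_n} | [&& #|p.1| == k, #|p.2| == k.+1 & p.1 \subset p.2]].

Definition eJ (n k : nat) : nat := #|Jedges n k|.

Definition adjb n (F : {set {set 'I_n} * {set 'I_n}}) (u v : {set 'I_n}) : bool :=
  ((u, v) \in F) || ((v, u) \in F).

Definition has_cycle n (F : {set {set 'I_n} * {set 'I_n}}) (m : nat) : bool :=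
  [exists v : {ffun 'I_m -> {set 'I_n}},
     injectiveb v && [forall i : 'I_m, adjb F (v i) (v (ordS i))]].

Definition exJ (n k m : nat) : nat :=
  \max_(F : {set {set 'I_n} * {set 'I_n}} | (F \subset Jedges n k) && ~~ has_cycle F m)
     #|F|.

(* Main.v *)
Require Import Defs.
From mathcomp Require Import all_boot zify.
From Stdlib Require Import Reals Lra.
(* Reals rebinds [^] in nat_scope. *)
From mathcomp Require Import ssrnat.
Set Implicit Arguments. Unset Strict Implicit. Unset Printing Implicit Defensive.

(** For a [(k-1)]-set [T], let the link of [T] be the graph on the points
    outside [T] in which [a ~ b] iff both [T+a] and [T+b] are joined to [T+a+b]
    in [F].  An [m]-cycle of the link yields a [2m]-cycle of [F].  Conversely, two
    distinct edges [(A, S)] and [(B, S)] of [F] form an ordered edge of the link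
    of [A :&: B], so if all links have at most [q (n-k)^2] ordered edges then
    Cauchy-Schwarz over the [N = C(n, k+1)] sets [S] gives
    [|F|^2 <= N |F| + q k (k+1) N^2].

    For large [n] any [q > 0] is allowed when [m] is even, since a dense graph
    contains every complete bipartite graph, and any [q > 1/2] when [m > 2] is
    odd.  Solving the quadratic inequality gives the coefficients
    [1/(k+1) + eps] and [1/(2(k+1)) + sqrt 2/2] for [n >= n0].  As
    [1/(k+1) < 1/sqrt (k+1)], in both parts the vanishing error term is needed
    only to absorb the finitely many [n < n0]. *)

(** * Counting *)

Lemma sum_leq_threshold (I : finType) (h : I -> nat) (t M : nat) :
  (forall i, h i <= M) ->
  \sum_i h i <= t * #|I| + M * #|[set i | t <= h i]|.
Proof.
move=> h_le; rewrite mulnC [M * _]mulnC -[_ * M]sum_nat_const -[_ * t]sum_nat_const.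
rewrite [X in _ + X]big_mkcond -big_split; apply: leq_sum => i _ /=.
by rewrite inE; case: (leqP t) (h_le i); lia.
Qed.

Lemma sqr_sum_leq (I : finType) (P : {set I}) (d : I -> nat) :
  (\sum_(i in P) d i) ^ 2 <= #|P| * \sum_(i in P) d i ^ 2.
Proof.
rewrite -(leq_pmul2l (isT : 0 < 2)) -mulnn big_distrlr /= big_distrr /=.
have -> : 2 * (#|P| * \sum_(i in P) d i ^ 2)
    = \sum_(i in P) \sum_(j in P) (d i ^ 2 + d j ^ 2).
  under [RHS]eq_bigr do rewrite big_split /= sum_nat_const.
  by rewrite big_split /= sum_nat_const -big_distrr /= mul2n addnn.
apply: leq_sum => i _; rewrite big_distrr /=.
by apply: leq_sum => j _; rewrite nat_Cauchy.
Qed.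

Section Fibers.
Variables (A B : finType) (f : A -> B) (P : {set A}) (Q : {set B}).
Hypothesis fPQ : {in P, forall x, f x \in Q}.

Definition fiber (b : B) : {set A} := [set x in P | f x == b].

Definition collisions : {set A * A} :=
  [set p in setX P P | (p.1 != p.2) && (f p.1 == f p.2)].

Lemma card_sum_fibers : #|P| = \sum_(b in Q) #|fiber b|.
Proof.
rewrite -sum1_card (partition_big f (mem Q)) //=.
by apply: eq_bigr => b _; rewrite sum1dep_card.
Qed.

Lemma exists_large_fiber (m : nat) :
  m * #|Q| < #|P| -> exists2 b, b \in Q & m < #|fiber b|.
Proof.
move=> P_big; apply/exists_inP; apply: contraTT P_big => /exists_inPn small.
rewrite -leqNgt card_sum_fibers mulnC -sum_nat_const.
by apply: leq_sum => b /small; rewrite -leqNgt.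
Qed.

End Fibers.

Lemma sum_sqr_card_fibers (A B : finType) (f : A -> B) (P : {set A}) (Q : {set B}) :
  {in P, forall x, f x \in Q} ->
  \sum_(b in Q) #|fiber f P b| ^ 2 = #|P| + #|collisions f P|.
Proof.
move=> fPQ; rewrite (card_sum_fibers fPQ).
rewrite (@card_sum_fibers _ _ (fun p => f p.1) _ Q); last first.
  by move=> p; rewrite !inE => /andP[/andP[/fPQ]].
rewrite -big_split; apply: eq_bigr => b _ /=.
rewrite -mulnn -cardsX -(cardsID [set p | p.1 == p.2]); congr (_ + _).
  rewrite -[RHS](card_imset _ (f := fun x => (x, x))); last by move=> x y [].
  apply: eq_card => -[x y]; rewrite !inE /=.
  apply/andP/imsetP => [[/andP[xb _] /eqP <-]|[z zb [-> ->]]].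
    by exists x; rewrite // inE.
  by rewrite inE in zb; rewrite eqxx zb.
apply: eq_card => -[x y]; rewrite !inE /=.
case: (x \in P); case: (y \in P); case: (x == y) => //=; rewrite ?andbF //.
by case: (f x =P b) => [->|]; rewrite ?andbT ?andbF // eq_sym.
Qed.

Lemma sqr_card_leq_collisions (A B : finType) (f : A -> B) (P : {set A}) (Q : {set B}) :
  {in P, forall x, f x \in Q} ->
  #|P| ^ 2 <= #|Q| * (#|P| + #|collisions f P|).
Proof.
move=> fPQ; rewrite -(sum_sqr_card_fibers fPQ) {1}(card_sum_fibers fPQ).
exact: sqr_sum_leq.
Qed.

Lemma subset_cardS_setD1 (X : finType) (A S : {set X}) : A \subset S -> #|S| = #|A|.+1 ->
  exists2 b, b \in S & A = S :\ b.
Proof.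
move=> AS cS; have /cards1P[b Sb] : #|S :\: A| == 1.
  by rewrite cardsDS // cS subSnn.
exists b; last by rewrite -Sb setDDr setDv set0U (setIidPr AS).
have : b \in S :\: A by rewrite Sb set11.
by rewrite !inE => /andP[].
Qed.

Lemma subset_pair_split (X : finType) (A B S : {set X}) :
  A != B -> A \subset S -> B \subset S ->
  #|S| = #|A|.+1 -> #|S| = #|B|.+1 ->
  exists a b, let T := A :&: B in
    [/\ a \notin T, b \notin T & a != b] /\
    [/\ A = a |: T, B = b |: T & S = a |: (b |: T)].
Proof.
move=> AB AS BS /(subset_cardS_setD1 AS)[b bS AE] /(subset_cardS_setD1 BS)[a aS BE].
have ab : a != b by apply: contraNneq AB => ab; rewrite AE BE ab.
exists a, b => /=; rewrite AE BE !inE !eqxx ab andbF.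
split; split=> //; apply/setP => x.
- by rewrite !inE; case: (eqVneq x a) => [->|_] /=; rewrite ?ab ?aS // -andbA andbb.
- rewrite !inE; case: (eqVneq x b) => [->|_] /=; rewrite ?bS ?(eq_sym b) ?ab //.
  by rewrite andbCA andbb.
- rewrite !inE; case: (eqVneq x a) => [->|_] //.
  by case: (eqVneq x b) => [->|_] //=; rewrite andbb.
Qed.

(** * Dense relations *)

Section Biclique.
Variables (V W : finType) (r : V -> W -> bool).

Definition edges : {set V * W} := [set p | r p.1 p.2].
Definition nbr (x : V) : {set W} := [set y | r x y].
Definition has_biclique (l : nat) : Prop :=
  exists A : {set V}, exists B : {set W},
    [/\ l <= #|A|, l <= #|B| & {in A & B, forall x y, r x y}].

Lemma card_edges : #|edges| = \sum_x #|nbr x|.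
Proof.
rewrite -sum1dep_card -(pair_big_dep predT r (fun _ _ => 1)) /=.
by apply: eq_bigr => x _; rewrite sum1dep_card.
Qed.

Lemma biclique_of_degree_sum (X : {set V}) (l : nat) :
  l * #|W| + #|X| * (l * 2 ^ #|X|) < \sum_(x in X) #|nbr x| -> has_biclique l.
Proof.
move=> X_deg; pose trace y := [set x in X | r x y].
have trace_sub y : trace y \subset X by apply/subsetP => x; rewrite inE => /andP[].
pose Y := [set y | l <= #|trace y|].
have double_count : \sum_(x in X) #|nbr x| = \sum_y #|trace y|.
  under eq_bigr do rewrite -sum1dep_card.
  rewrite (exchange_big_dep predT) //=.
  by apply: eq_bigr => y _; rewrite sum1dep_card.
have Y_big : l * #|powerset X| < #|Y|.
  have := @sum_leq_threshold _ (fun y => #|trace y|) l #|X|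
            (fun y => subset_leq_card (trace_sub y)).
  rewrite -double_count card_powerset => /(leq_trans X_deg).
  by rewrite ltn_add2l ltn_mul2l => /andP[].
have [|Z _ Z_big] := exists_large_fiber (f := trace) _ Y_big.
  by move=> y _; rewrite powersetE.
exists Z, (fiber trace Y Z); split; last 1 first.
- move=> x y xZ; rewrite inE => /andP[_ /eqP yZ].
  by move: xZ; rewrite -yZ inE => /andP[].
- have /card_gt0P[y] : 0 < #|fiber trace Y Z| by apply: leq_trans Z_big.
  by rewrite !inE => /andP[ly /eqP <-].
- exact: ltnW.
Qed.

(* A linear number of vertices have degree at least [#|W| / (2 D)]; any
   [4 D l] of them already have degree sum at least [2 l #|W|]. *)
Lemma dense_biclique (l D : nat) : 0 < l ->
  8 * D ^ 2 * l <= #|V| -> 4 * D * l * 2 ^ (4 * D * l) < #|W| ->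
  #|V| * #|W| < D * #|edges| -> has_biclique l.
Proof.
set M := 4 * D * l => l_gt0 V_big W_big dense.
have D_gt0 : 0 < D by case: posnP dense => [->|].
pose high := [set x | #|W| <= 2 * D * #|nbr x|].
have /card_geqP[s [s_uniq s_size s_high]] : M <= #|high|.
  have high_count : 2 * D * #|edges| <= #|W| * #|V| + 2 * D * #|W| * #|high|.
    rewrite card_edges big_distrr /=; apply: sum_leq_threshold => x.
    by rewrite leq_mul // max_card.
  have W_gt0 : 0 < #|W| by lia.
  have {high_count} : #|W| * #|V| < #|W| * (2 * D * #|high|) by lia.
  by rewrite ltn_pmul2l // => ?; rewrite /M; nia.
pose X : {set V} := [set x in s].
have cX : #|X| = M by rewrite cardsE (card_uniqP s_uniq).
apply: (@biclique_of_degree_sum X); rewrite cX.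
have : M * #|W| <= 2 * D * \sum_(x in X) #|nbr x|.
  rewrite -cX -sum_nat_const big_distrr /=; apply: leq_sum => x.
  by rewrite inE => /s_high; rewrite inE.
have -> : M * #|W| = 2 * D * (2 * (l * #|W|)) by rewrite /M; lia.
rewrite leq_pmul2l; last by lia.
by move: W_big; clear -l_gt0; nia.
Qed.

End Biclique.

(** * Cycles in dense graphs *)

Lemma cycle_nth (T : Type) (e : rel T) x0 (c : seq T) i :
  cycle e c -> i < size c -> e (nth x0 c i) (nth x0 c (i.+1 %% size c)).
Proof.
case: c => // x p /(pathP x0)/(_ i); rewrite size_rcons => c_path /[dup] ip /c_path.
rewrite -rcons_cons nth_rcons ip nth_rcons /=.
move: ip; rewrite /= ltnS leq_eqVlt => /predU1P[->|ip]; last by rewrite ip modn_small.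
by rewrite ltnn eqxx modnn.
Qed.

Lemma next_next_neq (T : eqType) (c : seq T) x :
  uniq c -> 2 < size c -> x \in c -> next c (next c x) != x.
Proof.
move=> c_uniq c_size /rot_to[i s c_rot]; rewrite -!(next_rot i c_uniq) c_rot.
move: c_uniq c_size; rewrite -(rot_uniq i) -(size_rot i) c_rot.
case: s {c_rot} => [|y [|z s]] //= /andP[]; rewrite !inE !negb_or.
case/and3P=> xy xz _ _ _.
by rewrite !eqxx !(eq_sym _ x) (negPf xy).
Qed.

Definition interleave (T1 T2 : Type) (f g : T1 -> T2) (c : seq T1) : seq T2 :=
  flatten [seq [:: f x; g x] | x <- c].

Lemma size_interleave (T1 T2 : Type) (f g : T1 -> T2) c :
  size (interleave f g c) = 2 * size c.
Proof. by elim: c => //= x c; rewrite /interleave /= => ->; lia. Qed.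

Lemma perm_interleave (T1 : Type) (T2 : eqType) (f g : T1 -> T2) c :
  perm_eq (interleave f g c) (map f c ++ map g c).
Proof.
elim: c => //= x c IH; rewrite perm_cons perm_sym.
by rewrite (perm_catCA (map f c) [:: g x]) /= perm_cons perm_sym.
Qed.

Lemma cycle_interleave (T1 T2 : Type) (e : rel T2) (f g : T1 -> T2) c :
  cycle e (interleave f g c) = cycle [rel x y | e (f x) (g x) && e (g x) (f y)] c.
Proof.
case: c => //= a c; rewrite -/(interleave f g c).
have -> x y : e (f x) (g x) && path e (g x) (rcons (interleave f g c) (f y))
    = path [rel x y | e (f x) (g x) && e (g x) (f y)] x (rcons c y) => //.
elim: c x => [|b c IH] x /=; first by rewrite andbA.
by rewrite -IH !andbA.
Qed.

Lemma ucycle_interleave (T1 T2 : eqType) (e : rel T2) (f g : T1 -> T2) c :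
  uniq (map f c ++ map g c) ->
  {in c, forall x, e (f x) (g x) && e (g x) (f (next c x))} ->
  ucycle e (interleave f g c).
Proof.
rewrite -(perm_uniq (perm_interleave f g c)) => fg_uniq e_next.
rewrite /ucycle fg_uniq andbT cycle_interleave; apply: cycle_from_next => //.
move: fg_uniq; rewrite (perm_uniq (perm_interleave f g c)) cat_uniq => /andP[].
by move/map_uniq.
Qed.

Definition has_ucycle (V : eqType) (e : rel V) (m : nat) : Prop :=
  exists2 c, ucycle e c & size c = m.

Section Graph.
Variables (V : finType) (e : rel V).
Hypotheses (e_sym : symmetric e) (e_irr : irreflexive e).

Lemma biclique_even_cycle (l : nat) : has_biclique e l -> has_ucycle e (2 * l).
Proof.
move=> [A [B [/card_geqP[s [s_uniq s_size sA]] /card_geqP[t [t_uniq t_size tB]] eAB]]].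
have fst_zip : unzip1 (zip s t) = s by rewrite unzip1_zip ?s_size ?t_size.
have snd_zip : unzip2 (zip s t) = t by rewrite unzip2_zip ?s_size ?t_size.
have fstA p : p \in zip s t -> p.1 \in A by move=> ?; apply: sA; rewrite -fst_zip map_f.
have sndB p : p \in zip s t -> p.2 \in B by move=> ?; apply: tB; rewrite -snd_zip map_f.
exists (interleave fst snd (zip s t)); last first.
  by rewrite size_interleave size1_zip ?s_size ?t_size.
apply: ucycle_interleave => [|p pc /=].
  rewrite -/(unzip1 _) -/(unzip2 _) fst_zip snd_zip cat_uniq s_uniq t_uniq andbT.
  apply/hasPn => x xt; apply/negP => xs.
  by have := eAB x x (sA x xs) (tB x xt); rewrite e_irr.
rewrite [e p.2 _]e_sym !eAB; auto.
by apply: fstA; rewrite mem_next.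
Qed.

Definition common_nbr (U : {set V}) (x y : V) : {set V} :=
  [set z in U | e x z & e z y].

Lemma common_nbr_avoid (U : {set V}) x y (s : seq V) :
  size s < #|common_nbr U x y| ->
  exists2 z, z \in U & [/\ z \notin s, e x z & e z y].
Proof.
move=> s_small; have /subsetPn[z] : ~~ (common_nbr U x y \subset s).
  apply: contraTN s_small => /subset_leq_card common_le.
  by rewrite -leqNgt (leq_trans common_le) // card_size.
by rewrite inE => /andP[zU /andP[xz zy]] zs; exists z.
Qed.

Section Codegree.
Variables (m : nat) (U : {set V}).
Hypothesis codegree_ge : {in U &, forall x y, m <= #|common_nbr U x y|}.

Lemma codegree_path x q : x \in U -> q < m -> exists p,
  [/\ size p = q, path e x p, uniq (x :: p) & last x p \in U].
Proof.
move=> xU; elim: q => [|q IH] qm; first by exists [::].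
have [p [p_size p_path p_uniq lU]] := IH (ltnW qm).
have [|z zU [zp lz _]] := @common_nbr_avoid U (last x p) (last x p) (x :: p).
  by apply: leq_trans (codegree_ge lU lU); rewrite /= p_size.
exists (rcons p z); split.
- by rewrite size_rcons p_size.
- by rewrite rcons_path p_path.
- by rewrite -rcons_cons rcons_uniq zp.
- by rewrite last_rcons.
Qed.

Lemma codegree_cycle : 2 < m -> U != set0 -> has_ucycle e m.
Proof.
move=> m_gt2 /set0Pn[x xU].
have [|p [p_size p_path p_uniq lU]] := @codegree_path x (m - 2) xU; first by lia.
have [|z zU [zp lz zx]] := @common_nbr_avoid U (last x p) x (x :: p).
  by apply: leq_trans (codegree_ge lU xU); rewrite /= p_size; lia.
exists (rcons (x :: p) z); last by rewrite size_rcons /= p_size; lia.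
apply/andP; split; last by rewrite rcons_uniq zp.
by rewrite /= rcons_path last_rcons rcons_path p_path lz zx.
Qed.

End Codegree.

Definition edges_in (U : {set V}) : {set V * V} := edges e :&: setX U U.

Lemma edges_in_setT : edges_in setT = edges e.
Proof. by apply/setP => -[x y]; rewrite !inE !andbT. Qed.

Lemma card_edges_in_leq (U : {set V}) : #|edges_in U| <= #|U| ^ 2.
Proof. by rewrite -mulnn -cardsX subset_leq_card // subsetIr. Qed.

Lemma card_edges_inD1 (U : {set V}) x : x \in U ->
  #|edges_in U| <= #|edges_in (U :\ x)| + 2 * #|nbr e x :&: U|.
Proof.
move=> xU; set N := nbr e x :&: U.
have sub : edges_in U \subset edges_in (U :\ x) :|: (setX [set x] N :|: setX N [set x]).
  apply/subsetP => -[a b]; rewrite !inE /= => /and3P[eab aU bU].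
  rewrite aU bU eab !andbT /=.
  case: (eqVneq a x) => [ax|_]; first by rewrite -ax eab.
  by case: (eqVneq b x) => [bx|_] //=; rewrite -bx e_sym eab.
apply: leq_trans (subset_leq_card sub) _.
apply: leq_trans (leq_card_setU _ _) _; rewrite leq_add2l.
apply: leq_trans (leq_card_setU _ _) _.
by rewrite !cardsX cards1; lia.
Qed.

(* [U] maximizes [b e(U) - a |U|^2]; the term [#|V| ^ 2] below keeps the
   subtraction from being truncated. *)
Lemma exists_min_degree_subset (a b : nat) : exists U : {set V},
  b * #|edges e| + a * #|U| ^ 2 <= a * #|V| ^ 2 + b * #|edges_in U| /\
  {in U, forall x, a * (2 * #|U| - 1) <= 2 * b * #|nbr e x :&: U|}.
Proof.
pose weight (U : {set V}) := b * #|edges_in U| + a * (#|V| ^ 2 - #|U| ^ 2).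
have [U _ /(_ _ isT) U_max] := @arg_maxnP _ setT predT weight isT.
have U_sqr : a * #|U| ^ 2 <= a * #|V| ^ 2 by rewrite leq_mul2l leq_sqr max_card orbT.
exists U; split=> [|x xU].
  have : weight setT <= weight U := U_max setT.
  rewrite /weight edges_in_setT cardsT subnn !mulnBr; lia.
have : weight (U :\ x) <= weight U := U_max (U :\ x).
have := leq_mul (leqnn b) (card_edges_inD1 xU).
rewrite /weight !mulnBr; move: U_sqr; rewrite (cardsD1 x U) xU sqrnD /=; lia.
Qed.

Lemma card_nbrI_leq (U : {set V}) x y :
  #|nbr e x :&: U| + #|nbr e y :&: U| <= #|U| + #|common_nbr U x y|.
Proof.
have -> : common_nbr U x y = (nbr e x :&: U) :&: (nbr e y :&: U).
  by apply/setP => z; rewrite !inE (e_sym y); case: (z \in U); rewrite ?andbF ?andbT.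
by rewrite -cardsUI leq_add2r subset_leq_card // subUset !subsetIr.
Qed.

Lemma dense_cycle (m D : nat) : 2 < m ->
  2 * D * (2 * D * m + D + 1) <= #|V| ->
  (D + 1) * #|V| ^ 2 < 2 * D * #|edges e| -> has_ucycle e m.
Proof.
move=> m_gt2 V_big dense.
have D_gt0 : 0 < D by case: posnP dense => [->|].
have [U [U_dense U_deg]] := exists_min_degree_subset (2 * D + 1) (4 * D).
have {dense U_dense} U_sqr : #|V| ^ 2 <= 2 * D * #|U| ^ 2.
  have := leq_mul (leqnn (4 * D)) (card_edges_in_leq U); lia.
have {V_big U_sqr} U_big : 2 * D * m + D + 1 <= #|U|.
  rewrite leqNgt; apply/negP => U_small.
  have : (2 * D * #|U|) ^ 2 < #|V| ^ 2 by rewrite ltn_sqr; nia.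
  by rewrite ltnNge (leq_trans U_sqr) // expnMn leq_mul2r; apply/orP; right; nia.
apply: (@codegree_cycle m U) => //; last by rewrite -card_gt0; lia.
move=> x y xU yU.
rewrite -(leq_pmul2l (_ : 0 < 8 * D)); last by lia.
have := leq_mul (leqnn (8 * D)) (card_nbrI_leq U x y).
have := U_deg x xU; have := U_deg y yU; move: U_big D_gt0; clear.
rewrite mulnBr; lia.
Qed.

End Graph.

Definition density_forces_cycle (p : R) (m : nat) : Prop :=
  exists n0, forall (V : finType) (e : rel V), symmetric e -> irreflexive e ->
    n0 <= #|V| -> (p * INR #|V| ^ 2 < INR #|edges e|)%R -> has_ucycle e m.

Lemma pos_density_forces_even_cycle (p : R) l :
  0 < l -> (0 < p)%R -> density_forces_cycle p (2 * l).
Proof.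
move=> l_gt0 p_gt0; have [D [D_inv D_gt0]] := archimed_cor1 p p_gt0.
exists (8 * D ^ 2 * l + (4 * D * l * 2 ^ (4 * D * l)).+1).
move=> V e e_sym e_irr V_big dense.
apply: biclique_even_cycle => //; apply: (@dense_biclique _ _ _ l D) => //; try lia.
have D_pos : (0 < INR D)%R by apply: lt_0_INR.
apply/ltP/INR_lt; rewrite -!multE !mult_INR.
have : (1 < INR D * p)%R.
  by rewrite -(Rinv_r (INR D)); [apply: Rmult_lt_compat_l|lra].
have := pos_INR #|V|; nra.
Qed.

Lemma gt_half_density_forces_cycle (p : R) m :
  2 < m -> (1 / 2 < p)%R -> density_forces_cycle p m.
Proof.
move=> m_gt2 p_gt; have [|D [D_inv D_gt0]] := archimed_cor1 (2 * p - 1); first lra.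
exists (2 * D * (2 * D * m + D + 1)) => V e e_sym e_irr V_big dense.
apply: (@dense_cycle _ _ e_sym m D) => //.
have D_pos : (0 < INR D)%R by apply: lt_0_INR.
apply/ltP/INR_lt; rewrite -mulnn -!multE -plusE !mult_INR plus_INR [INR 1]/= [INR 2]/=.
have : (1 < INR D * (2 * p - 1))%R.
  by rewrite -{1}(Rinv_r (INR D)); [apply: Rmult_lt_compat_l|lra].
have := pos_INR #|V|; nra.
Qed.

(** * Links *)

Section Link.
Variable n : nat.
Implicit Types (F : {set {set 'I_n} * {set 'I_n}}) (T : {set 'I_n}).

Lemma has_ucycle_has_cycle F m : has_ucycle (adjb F) m -> has_cycle F m.
Proof.
case=> c /andP[c_cycle c_uniq] c_size.
apply/existsP; exists [ffun i : 'I_m => nth set0 c i]; apply/andP; split.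
  apply/injectiveP => i j; rewrite !ffunE => /eqP.
  by rewrite nth_uniq ?c_size // => /eqP/val_inj.
apply/forallP => i; rewrite !ffunE /=.
by have := cycle_nth set0 c_cycle; rewrite c_size; apply.
Qed.

Definition link F T : rel 'I_n := [rel a b |
  [&& a \notin T, b \notin T, a != b,
      (a |: T, a |: (b |: T)) \in F & (b |: T, a |: (b |: T)) \in F]].

Lemma link_sym F T : symmetric (link F T).
Proof.
move=> a b; rewrite /link /= setUCA (eq_sym b a).
by rewrite andbCA; do 3![congr (_ && _)]; rewrite andbC.
Qed.

Lemma link_irr F T : irreflexive (link F T).
Proof. by move=> a; rewrite /link /= eqxx !andbF. Qed.

(* The vertices of the cycle in [F] are the sets [a + T] and [a + b + T], for
   [a] a vertex and [{a, b}] an edge of the cycle in the link. *)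
Lemma link_cycle F T m : 2 < m -> has_ucycle (link F T) m -> has_cycle F (2 * m).
Proof.
move=> m_gt2 [c /andP[c_cycle c_uniq] c_size]; apply: has_ucycle_has_cycle.
have c_link a : a \in c -> link F T a (next c a) by exact: next_cycle.
have c_out a : a \in c -> a \notin T by case/c_link/and5P.
pose f a := a |: T; pose g a := a |: (next c a |: T).
have f_inj : {in c &, injective f}.
  move=> a b ac bc /setP/(_ a).
  by rewrite !inE eqxx (negPf (c_out a ac)) !orbF => /esym/eqP.
have g_inj : {in c &, injective g}.
  move=> a b ac bc gab; apply/eqP/negPn/negP => ab.
  have mem_g x y : x \in c -> (x \in g y) = (x == y) || (x == next c y).
    by move=> /c_out xT; rewrite !inE (negPf xT) orbF.
  have : a \in g b by rewrite -gab mem_g ?eqxx.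
  rewrite mem_g // (negPf ab) => /eqP a_next.
  have : b \in g a by rewrite gab mem_g ?eqxx.
  rewrite mem_g // eq_sym (negPf ab) => /eqP b_next.
  have := next_next_neq c_uniq _ ac.
  by rewrite -b_next -a_next eqxx c_size => /(_ m_gt2).
exists (interleave f g c); last by rewrite size_interleave c_size.
apply: ucycle_interleave => [|a ac].
  rewrite cat_uniq !map_inj_in_uniq // c_uniq andbT.
  apply/hasPn => _ /mapP[b bc ->]; apply/mapP => -[a ac].
  move/(congr1 (fun S : {set 'I_n} => #|S|)).
  have /and5P[bT nextT b_next _ _] := c_link b bc.
  rewrite /f /g !cardsU1 !inE !negb_or bT nextT b_next c_out //=; lia.
have /and5P[_ _ _ edge_a edge_next] := c_link a ac.
by rewrite /adjb edge_a edge_next orbT.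
Qed.

Definition link_collision T (ab : 'I_n * 'I_n) :=
  let: (a, b) := ab in let S := a |: (b |: T) in ((a |: T, S), (b |: T, S)).

Lemma collision_link_edge F k p : F \subset Jedges n k -> p \in collisions snd F ->
  let T := p.1.1 :&: p.2.1 in
  #|T| = k.-1 /\ exists2 ab, ab \in edges (link F T) & p = link_collision T ab.
Proof.
move=> FJ; case: p => -[A S] [B S'].
rewrite !inE /= => /andP[/andP[AS BS] /andP[neq /eqP SS']].
move: neq BS; rewrite -{}SS' xpair_eqE eqxx andbT => AB BS.
have := subsetP FJ _ AS; have := subsetP FJ _ BS; rewrite !inE /=.
move=> /and3P[/eqP cB /eqP cS sB] /and3P[/eqP cA _ sA].
have [||a [b /= [[aT bT ab] [AE BE SE]]]] := subset_pair_split AB sA sB.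
- by rewrite cS cA.
- by rewrite cS cB.
split; first by rewrite -cA [in RHS]AE cardsU1 aT.
exists (a, b); last by rewrite /= -SE -AE -BE.
by rewrite inE; apply/and5P; split; rewrite //= -SE -?AE -?BE.
Qed.

Lemma card_collisions_leq F k : F \subset Jedges n k ->
  #|collisions snd F|
    <= \sum_(T in [set T : {set 'I_n} | #|T| == k.-1]) #|edges (link F T)|.
Proof.
move=> FJ; rewrite (@card_sum_fibers _ _ (fun p => p.1.1 :&: p.2.1) _
  [set T : {set 'I_n} | #|T| == k.-1]); last first.
  by move=> p /(collision_link_edge FJ)[cT _]; rewrite inE cT.
apply: leq_sum => T _; apply: leq_trans (leq_imset_card (link_collision T) _).
apply/subset_leq_card/subsetP => p; rewrite inE => /andP[/(collision_link_edge FJ)].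
case=> _ [ab ab_link pE] /eqP TE.
by apply/imsetP; exists ab; rewrite -TE.
Qed.

End Link.

Lemma eJE n k : eJ n k = k.+1 * 'C(n, k.+1).
Proof.
rewrite /eJ.
rewrite (@card_sum_fibers _ _ snd _ [set S : {set 'I_n} | #|S| == k.+1]); last first.
  by move=> p; rewrite !inE => /and3P[].
rewrite -[n in RHS]card_ord -card_draws mulnC -sum_nat_const.
apply: eq_bigr => S; rewrite inE => cS.
have -> : k.+1 = #|[set A : {set 'I_n} | A \subset S & #|A| == k]|.
  by rewrite cards_draws (eqP cS) -bin_sub // subSnn bin1.
rewrite -[RHS](card_imset _ (f := fun A => (A, S))); last by move=> A B [].
apply: eq_card => -[A B]; rewrite !inE /=.
apply/andP/imsetP => [[/and3P[cA _ AB] /eqP <-]|[C]].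
  by exists A; rewrite // inE AB.
by rewrite inE => /andP[CS cC] [-> ->]; rewrite cS cC CS.
Qed.

Lemma bin_predn_leq n k : 0 < k ->
  'C(n, k.-1) * (n - k) ^ 2 <= k * k.+1 * 'C(n, k.+1).
Proof.
move=> k_gt0; have := mul_bin_left n k.-1; rewrite prednK // => bin_k.
rewrite -mulnA mul_bin_left mulnCA bin_k -mulnn mulnC -mulnA.
by rewrite !leq_mul // leq_sub2l // leq_pred.
Qed.

Lemma sqr_card_leq_link n k m (F : {set {set 'I_n} * {set 'I_n}}) :
  F \subset Jedges n k -> (forall T, #|edges (link F T)| <= m) ->
  #|F| ^ 2 <= 'C(n, k.+1) * (#|F| + 'C(n, k.-1) * m).
Proof.
move=> FJ link_le.
have snd_card : {in F, forall p, p.2 \in [set S : {set 'I_n} | #|S| == k.+1]}.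
  by move=> p /(subsetP FJ); rewrite !inE => /and3P[].
apply: leq_trans (sqr_card_leq_collisions snd_card) _.
rewrite card_draws card_ord leq_mul2l leq_add2l; apply/orP; right.
apply: leq_trans (card_collisions_leq FJ) _.
apply: leq_trans (leq_sum _ (fun T _ => link_le T)) _.
by rewrite sum_nat_const card_draws card_ord.
Qed.

(** * From densities to Turan numbers *)

Lemma INR_bigmax_le (I : finType) (P : pred I) (h : I -> nat) (B : R) :
  (0 <= B)%R -> (forall i, P i -> (INR (h i) <= B)%R) ->
  (INR (\max_(i | P i) h i) <= B)%R.
Proof.
move=> B_ge0 h_le; apply: (big_ind (fun x => (INR x <= B)%R)) => // x y xB yB.
by rewrite /maxn; case: ifP.
Qed.

Lemma INR_exJ_le n k m (a : R) :
  (1 <= a)%R -> (INR (exJ n k m) <= a * INR (eJ n k))%R.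
Proof.
move=> a_ge1; have : (INR (exJ n k m) <= INR (eJ n k))%R.
  by apply/le_INR/leP/bigmax_leqP => F /andP[/subset_leq_card].
have := pos_INR (eJ n k); nra.
Qed.

Lemma sqr_sub_eventually_ge k (p q : R) : (0 <= p < q)%R ->
  exists n0, forall n, n0 <= n -> (p * INR n ^ 2 <= q * INR (n - k) ^ 2)%R.
Proof.
move=> [p_ge0 pq]; have [n1 n1_gt] := INR_unbounded (2 * INR k * q / (q - p)).
exists (n1 + k) => n n_ge; rewrite minus_INR; last by lia.
have n_large : (2 * INR k * q <= INR n * (q - p))%R.
  have n1_le : (INR n1 <= INR n)%R by apply: le_INR; lia.
  have -> : (2 * INR k * q = 2 * INR k * q / (q - p) * (q - p))%R by field; lra.
  by apply: Rmult_le_compat_r; lra.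
have := Rmult_le_compat_l _ _ _ (pos_INR n) n_large.
have := Rmult_le_pos _ _ (_ : 0 <= q)%R (pow2_ge_0 (INR k)); nra.
Qed.

Lemma INR_sqr_card_le_link n k (q : R) (F : {set {set 'I_n} * {set 'I_n}}) :
  0 < k -> (0 <= q)%R -> F \subset Jedges n k ->
  (forall T, (INR #|edges (link F T)| <= q * INR (n - k) ^ 2)%R) ->
  (INR #|F| * INR #|F| <= INR 'C(n, k.+1) * INR #|F|
     + q * (INR k * (INR k + 1)) * (INR 'C(n, k.+1) * INR 'C(n, k.+1)))%R.
Proof.
move=> k_gt0 q_ge0 FJ link_le; set N := INR 'C(n, k.+1).
pose m := \max_T #|edges (link F T)|.
have m_le : (INR m <= q * INR (n - k) ^ 2)%R.
  by apply: INR_bigmax_le => //; apply: Rmult_le_pos => //; apply: pow2_ge_0.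
have := sqr_card_leq_link FJ (fun T => leq_bigmax T : _ <= m).
move/leP/le_INR; rewrite -mulnn -plusE -!multE mult_INR [INR (_ * (_ + _))]mult_INR.
rewrite plus_INR mult_INR -/N => F_le.
have /leP/le_INR := bin_predn_leq n k_gt0.
rewrite -mulnn -!multE !mult_INR S_INR -/N => binR.
have := Rmult_le_compat_l _ _ _ (pos_INR 'C(n, k.-1)) m_le.
have := Rmult_le_compat_l _ _ _ q_ge0 binR.
have : (0 <= N)%R by apply: pos_INR.
nra.
Qed.

Lemma le_of_quadratic (x N t q : R) : (0 <= N)%R -> (1 <= t)%R ->
  (q <= t * t - t)%R -> (x * x <= N * x + q * (N * N))%R -> (x <= N * t)%R.
Proof.
move=> N_ge0 t_ge1 qt xq; apply: Rnot_lt_le => Ntx.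
have N_le : (N <= N * t)%R by nra.
have : (q * (N * N) <= (t * t - t) * (N * N))%R by apply: Rmult_le_compat_r => //; nra.
have : (N * t * (x - N) < x * (x - N))%R by apply: Rmult_lt_compat_r; lra.
have : (N * t * (N * t - N) <= N * t * (x - N))%R by apply: Rmult_le_compat_l; nra.
lra.
Qed.

Lemma exJ_eventually_le_of_density k m (p q t : R) :
  0 < k -> 2 < m -> density_forces_cycle p m -> (0 <= p < q)%R -> (1 <= t)%R ->
  (q * (INR k * (INR k + 1)) <= t * t - t)%R ->
  exists n0, forall n, n0 <= n ->
    (INR (exJ n k (2 * m)) <= t / (INR k + 1) * INR (eJ n k))%R.
Proof.
move=> k_gt0 m_gt2 [n1 forced] pq t_ge1 qt.
have [n2 n2_ge] := sqr_sub_eventually_ge k pq.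
exists (n1 + n2) => n n_ge; have kR := pos_INR k.
have -> : (t / (INR k + 1) * INR (eJ n k) = INR 'C(n, k.+1) * t)%R.
  by rewrite eJE mult_INR S_INR; field; lra.
have N_ge0 := pos_INR 'C(n, k.+1).
apply: INR_bigmax_le => [|F /andP[FJ noC]]; first by nra.
apply: (le_of_quadratic N_ge0 t_ge1 qt); apply: INR_sqr_card_le_link => //.
  lra.
move=> T; apply: Rle_trans (n2_ge n _); last by lia.
apply: Rnot_lt_le => dense; move/negP: noC; apply; apply: (link_cycle m_gt2).
apply: (forced _ _ (link_sym F T) (link_irr F T)); rewrite card_ord //; lia.
Qed.

Lemma exJ_even_eventually_le k l (eps : R) : 0 < k -> 1 < l -> (0 < eps)%R ->
  exists n0, forall n, n0 <= n ->
    (INR (exJ n k (4 * l)) <= (1 / (INR k + 1) + eps) * INR (eJ n k))%R.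
Proof.
move=> k_gt0 l_gt1 eps_gt0; have kR : (0 < INR k)%R by apply: lt_0_INR; lia.
have p_gt0 : (0 < eps / (2 * INR k))%R by apply: Rdiv_lt_0_compat; lra.
have q_gt : (eps / (2 * INR k) < eps / INR k)%R.
  have -> : (eps / INR k = 2 * (eps / (2 * INR k)))%R by field; lra.
  lra.
have -> : 4 * l = 2 * (2 * l) by rewrite mulnA.
have -> : (1 / (INR k + 1) + eps = (1 + eps * (INR k + 1)) / (INR k + 1))%R.
  by field; lra.
apply: (exJ_eventually_le_of_density k_gt0 _
  (pos_density_forces_even_cycle (ltnW l_gt1) p_gt0) (conj (Rlt_le _ _ p_gt0) q_gt)).
- lia.
- nra.
have -> : (eps / INR k * (INR k * (INR k + 1)) = eps * (INR k + 1))%R by field; lra.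
nra.
Qed.

Lemma exJ_odd_eventually_le k l : 0 < k -> 0 < l ->
  exists n0, forall n, n0 <= n ->
    (INR (exJ n k (4 * l + 2))
       <= (1 / (2 * (INR k + 1)) + sqrt 2 / 2) * INR (eJ n k))%R.
Proof.
move=> k_gt0 l_gt0; have k_ge1 : (1 <= INR k)%R by apply: (le_INR 1); lia.
have kV_gt0 : (0 < / INR k)%R by apply: Rinv_0_lt_compat; lra.
have kVK : (INR k * / INR k = 1)%R by apply: Rinv_r; lra.
have sqrt2_sqr : (sqrt 2 * sqrt 2 = 2)%R by rewrite sqrt_sqrt; lra.
have sqrt2_ge1 : (1 <= sqrt 2)%R by rewrite -{1}sqrt_1; apply: sqrt_le_1_alt; lra.
pose t := (1 / 2 + (INR k + 1) * (sqrt 2 / 2))%R.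
have t_sqr : (t * t - t = (INR k + 1) * (INR k + 1) / 2 - 1 / 4)%R by rewrite /t; nra.
have -> : 4 * l + 2 = 2 * (2 * l + 1) by lia.
have -> : (1 / (2 * (INR k + 1)) + sqrt 2 / 2 = t / (INR k + 1))%R.
  by rewrite /t; field; lra.
(* [q k (k+1) = (2 k + 1) (k + 1) / 4] for this choice of [q]. *)
apply: (@exJ_eventually_le_of_density k _
  (1 / 2 + / INR k / 8) (1 / 2 + / INR k / 4)) => //.
- lia.
- by apply: gt_half_density_forces_cycle; [lia|lra].
- lra.
- by rewrite /t; nra.
- by rewrite t_sqr; nra.
Qed.

Lemma Rpower_npos_absorbs (a : R) (n : nat) : (a <= 0)%R ->
  exists2 c : R, (0 <= c)%R &
    forall m : nat, 0 < m <= n -> (1 <= c * Rpower (INR m) a)%R.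
Proof.
move=> a_le0; exists (Rpower (INR n) (- a)); first by apply/Rlt_le/exp_pos.
move=> m /andP[m_gt0 mn]; have m_pos : (0 < INR m)%R by apply/lt_0_INR/ltP.
have -> : 1%R = (Rpower (INR m) (- a) * Rpower (INR m) a)%R.
  by rewrite -Rpower_plus Rplus_opp_l Rpower_O.
apply: Rmult_le_compat_r; first by apply/Rlt_le/exp_pos.
by apply: Rle_Rpower_l; [lra|split=> //; apply/le_INR/leP].
Qed.

Lemma inv_lt_inv_sqrt (x : R) : (1 < x)%R -> (1 / x < 1 / sqrt x)%R.
Proof.
move=> x_gt1; rewrite /Rdiv !Rmult_1_l; apply: Rinv_lt_contravar.
  by apply: Rmult_lt_0_compat; [apply: sqrt_lt_R0|]; lra.
by apply: sqrt_less; lra.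
Qed.

Lemma even_cycle_exponent_le0 l :
  0 < l -> (- (1 / 2) + 1 / (2 * INR l) <= 0)%R.
Proof.
move=> l_gt0; have l_ge1 : (1 <= INR l)%R by apply: (le_INR 1); lia.
have : (1 / (2 * INR l) <= 1 / 2)%R; last by lra.
by apply: Rmult_le_compat_l; [lra|apply: Rinv_le_contravar; lra].
Qed.

Theorem theorem1p1 (k l : nat) (hk : (0 < k)%N) (hl : (0 < l)%N) :
  ((2 <= l)%N ->
    exists c : R, forall n : nat, (2 * k + 1 <= n)%N ->
      (INR (exJ n k (4 * l)) <=
        (c * Rpower (INR (n - k)) (- (1 / 2) + 1 / (2 * INR l))
          + 1 / sqrt (INR (k + 1))) * INR (eJ n k))%R)
  /\
  (exists f : nat -> R, Un_cv f 0%R /\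
    forall n : nat, (2 * k + 1 <= n)%N ->
      (INR (exJ n k (4 * l + 2)) <=
        (1 / (2 * INR (k + 1)) + sqrt 2 / 2 + f n) * INR (eJ n k))%R).
Proof.
rewrite (_ : INR (k + 1) = INR k + 1)%R; last by rewrite addn1 S_INR.
have k_ge1 : (1 <= INR k)%R by apply: (le_INR 1); lia.
split=> [l_ge2|].
  have gap : (0 < 1 / sqrt (INR k + 1) - 1 / (INR k + 1))%R.
    by have := inv_lt_inv_sqrt (x := INR k + 1); lra.
  have [n0 large] := exJ_even_eventually_le hk l_ge2 gap.
  have [c c_ge0 absorb] := Rpower_npos_absorbs n0 (even_cycle_exponent_le0 hl).
  exists c => n n_ge; have [n_big|n_small] := leqP n0 n.
    apply: Rle_trans (large n n_big) _; apply: Rmult_le_compat_r; first exact: pos_INR.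
    set x := Rpower _ _; have : (0 <= c * x)%R; last by lra.
    by apply: Rmult_le_pos => //; apply/Rlt_le/exp_pos.
  apply: INR_exJ_le; have /absorb : 0 < n - k <= n0 by lia.
  have : (0 < 1 / (INR k + 1))%R by apply: Rdiv_lt_0_compat; lra.
  lra.
have [n0 large] := exJ_odd_eventually_le hk hl.
exists (fun n => if n0 <= n then 0%R else 1%R); split=> [eps eps_gt0|n _].
  by exists n0 => n /leP ->; rewrite R_dist_eq.
case: leqP => [n_big|_]; first by rewrite Rplus_0_r; apply: large.
apply: INR_exJ_le; have := sqrt_pos 2.
have : (0 < 1 / (2 * (INR k + 1)))%R by apply: Rdiv_lt_0_compat; lra.
lra.
Qed.
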